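(* The following statements hold. (1) For every integer $n\ge 5$, $\mathsf{s}^{(2)}(\mathbb{Z}_n)=n+2$. (2) For every prime $p\ge 5$ and every integer $k$ with $2\le k\le p-1$, $\mathsf{s}^{(k)}(\mathbb{Z}_p)\le p+k$. Furthermore, for each integer $k\ge 2$ there exists an integer $p_0(k)$ such that $\mathsf{s}^{(k)}(\mathbb{Z}_p)=p+k$ for all primes $p\ge p_0(k)$ (with $k\le p-1$). (3) There exist absolute constants $c,C>0$ such that for all integers $n,k$ with $2\le k\le n-1$: every sequence $\mathbf{x}\in\mathcal{X}_k(n,\lceil C\sqrt{nk}\rceil)$ is a Davenport Z-sequence, and there exists a sequence $\mathbf{y}\in\mathcal{X}_k(n,\lfloor c\sqrt{nk}\rfloor)$ that is not a Davenport Z-sequence.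
   Context: $\mathbb{Z}_n$ is the cyclic group (ring) of integers modulo $n$. A $\mathbb{Z}_n$-sequence of length $m$ is a tuple $\mathbf{x}=(x_1,\dots,x_m)\in(\mathbb{Z}_n)^m$; the multiplicity of $x\in\mathbb{Z}_n$ in $\mathbf{x}$ is the number of indices $i$ with $x_i=x$. For positive integers $k,n$ and an integer $m\ge 0$, $$\mathcal{X}_k(n,m):=\{\mathbf{x}\in(\mathbb{Z}_n)^m:\ \text{every }x\in\mathbb{Z}_n\text{ has multiplicity at most }k\text{ in }\mathbf{x}\}.$$ A $\mathbb{Z}_n$-sequence $\mathbf{x}=(x_1,\dots,x_m)$ is a Davenport Z-sequence if there is a non-empty $I\subseteq\{1,\dots,m\}$ with $\sum_{i\in I}x_i=0$ in $\mathbb{Z}_n$. It is an Erdős Z-sequence if there is $I\subseteq\{1,\dots,m\}$ with $|I|=n$ and $\sum_{i\in I}x_i=0$ in $\mathbb{Z}_n$. $\mathsf{s}^{(k)}(\mathbb{Z}_n)$ denotes the least integer $m$ such that every $\mathbf{x}\in\mathcal{X}_k(n,m)$ is an Erdős Z-sequence, where $m$ ranges over positive integers. *)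

(* Defs.v *)
From mathcomp Require Import all_boot all_order all_algebra.
From mathcomp Require Import reals.

Set Implicit Arguments.
Unset Strict Implicit.
Unset Printing Implicit Defensive.

Import GRing.Theory.
Local Open Scope ring_scope.

(* 'Z_n is the ring of integers mod n only when 1 < n ('Z_0 and 'Z_1 both     *)
(* denote the integers mod 2), so these notions are meant for 1 < n.          *)

Definition Xseq (k n m : nat) : {set m.-tuple 'Z_n} :=
  [set x : m.-tuple 'Z_n | [forall a, (count_mem a x <= k)%N]].

Definition davenportZ (n m : nat) (x : m.-tuple 'Z_n) : bool :=
  [exists I : {set 'I_m}, (I != set0) && (\sum_(i in I) tnth x i == 0)].

Definition erdosZ (n m : nat) (x : m.-tuple 'Z_n) : bool :=
  [exists I : {set 'I_m}, (#|I| == n) && (\sum_(i in I) tnth x i == 0)].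

Arguments davenportZ n {m} x.
Arguments erdosZ n {m} x.

Definition all_erdosZ (k n m : nat) : bool :=
  [forall x in Xseq k n m, erdosZ n x].

(* For m > k * #|'Z_n| the set Xseq k n m is empty, so the minimum defining   *)
(* s^(k)(Z_n), written [s_inv k n] below, always exists.                      *)
Lemma ex_all_erdosZ (k n : nat) :
  exists m : nat, (0 < m)%N && all_erdosZ k n m.
Proof.
exists (k * #|{: 'Z_n}|).+1; rewrite /=; apply/forall_inP => x.
rewrite inE => /forallP x_le; exfalso.
have: (\sum_(a : 'Z_n) count_mem a x <= \sum_(a : 'Z_n) k)%N.
  by apply: leq_sum => a _; apply: x_le.
suff -> : (\sum_(a : 'Z_n) count_mem a x = size x)%N.
  by rewrite size_tuple sum_nat_const mulnC ltnn.
elim: (tval x) => [|b s IHs]; first by rewrite big1.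
rewrite /= big_split /= IHs (bigD1 b) //= eqxx big1 ?addn0 // => a.
by rewrite eq_sym => /negbTE->.
Qed.

Definition s_inv (k n : nat) : nat := ex_minn (ex_all_erdosZ k n).

(* Main.v *)
Require Import Defs.
From HB Require Import structures.
From mathcomp Require Import all_boot all_order all_algebra all_fingroup.
From mathcomp Require Import reals.
From mathcomp Require Import zify.

Set Implicit Arguments.
Unset Strict Implicit.
Unset Printing Implicit Defensive.

Import Order.TTheory GRing.Theory Num.Theory.
Local Open Scope ring_scope.

(* Passing to complements, an n-term zero-sum subsequence of a sequence of    *)
(* length n + k is a choice of k terms adding up to the total sum. For k = 2  *)
(* it exists by counting the pairs {a, sigma - a}; for n = p prime the        *)
(* sequence splits into k nonempty sets and Cauchy-Davenport applies. The     *)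
(* lower bounds come from a sequence of length n + 1 without its own sum, and *)
(* from a sequence in a short interval [0, L] with sum -1 modulo p, which     *)
(* k - 1 terms, adding up to at most (k - 1) L < p - 1, cannot reach.         *)
(*                                                                            *)
(* For (3), a zero-sum free set A has at least |A|^2 / 672 subset sums        *)
(* (Olson). If a proper subgroup H contains 3/4 of A but not all of A, an     *)
(* element of A outside H doubles the number of subset sums of A n H, and     *)
(* induction applies as 2 (3/4)^2 >= 1. Otherwise any 3/4 of A generates the  *)
(* same subgroup as A, and one adds |A|/4 elements one at a time, each chosen *)
(* so that the set of subset sums grows by a constant proportion of |A|. A    *)
(* sequence with multiplicities at most k splits into k sets, whose numbers   *)
(* of nonempty subset sums add up by Kemperman-Scherk.                        *)

(** * Sumsets *)

(** Apart from the double count for k = 2, the upper bounds rest on sumset inequalities.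
    [Dyson_transform] yields both Cauchy-Davenport, used for primes through
    [Cauchy_Davenport_subseq], and the Kemperman-Scherk bound for sets in which 0 has only the
    trivial representation, as happens for the subset sums of two disjoint parts of a zero-sum free
    sequence.

    The two bounds in (3) match because a zero-sum free sequence of length m with multiplicities at
    most k has at least of order m^2 / k subset sums ([leq_sqr_size_ssum]), while only n are
    available. Conversely, listing 1, 2, 3, ... with each value k times costs an integer total of
    order m^2 / k, and positive integers of total below n have no nonempty zero sum modulo n. *)

Section Sumsets.
Variable G : finZmodType.
Implicit Types (A B C X S T U : {set G}) (a b g x y : G).

Definition addS A B : {set G} := [set a + b | a in A, b in B].

Lemma addSP A B g :
  reflect (exists a b, [/\ a \in A, b \in B & g = a + b]) (g \in addS A B).
Proof.
by apply: (iffP imset2P) => [[a b Aa Bb ->]|[a [b [Aa Bb ->]]]]; exists a b || exists a, b.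
Qed.

Lemma mem_addS A B a b : a \in A -> b \in B -> a + b \in addS A B.
Proof. by move=> Aa Bb; apply/addSP; exists a, b. Qed.

Lemma addSC : commutative addS.
Proof.
move=> A B; apply/setP => g.
by apply/addSP/addSP => -[a [b [Aa Bb ->]]]; exists b, a; rewrite addrC.
Qed.

Lemma addSA : associative addS.
Proof.
move=> A B C; apply/setP => g; apply/addSP/addSP.
  case=> a [_ [Aa /addSP[b [c [Bb Cc ->]]] ->]].
  by exists (a + b), c; rewrite mem_addS ?addrA.
case=> _ [c [/addSP[a [b [Aa Bb ->]]] Cc ->]].
by exists a, (b + c); rewrite mem_addS ?addrA.
Qed.

Lemma add0S : left_id [set 0] addS.
Proof.
move=> A; apply/setP => g; apply/addSP/idP => [[a [b [/set1P-> Ab ->]]]|Ag].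
  by rewrite add0r.
by exists 0, g; rewrite set11 add0r.
Qed.

HB.instance Definition _ := Monoid.isComLaw.Build _ [set 0] addS
  addSA addSC add0S.

Lemma addSS A A' B B' : A \subset A' -> B \subset B' -> addS A B \subset addS A' B'.
Proof.
move=> /subsetP AA' /subsetP BB'; apply/subsetP => _ /addSP[a [b [Aa Bb ->]]].
by rewrite mem_addS ?AA' ?BB'.
Qed.

Lemma subset_addSl A B : 0 \in B -> A \subset addS A B.
Proof. by move=> B0; apply/subsetP => a Aa; rewrite -[a]addr0 mem_addS. Qed.

Lemma card_translate A g : #|[set a + g | a in A]| = #|A|.
Proof. by rewrite card_imset //; apply: addIr. Qed.

(* Dyson's e-transform [A := A U (e + B), B := B n (A - e)], iterated until B *)
(* can no longer be shrunk, i.e. until every translate of B by A lies in A.   *)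
Lemma Dyson_transform A B : 0 \in A -> 0 \in B ->
  exists A' B', [/\ 0 \in A' /\ 0 \in B', (#|A'| + #|B'| = #|A| + #|B|)%N,
    A' \subset addS A B, addS A' B' \subset A' &
    (forall a, a \in A -> - a \in B -> a = 0) ->
    forall a, a \in A' -> - a \in B' -> a = 0].
Proof.
have [n] := ubnP #|B|; elim: n A B => // n IHn A B leBn A0 B0.
have [AB|] := boolP (addS A B \subset A).
  by exists A, B; rewrite subset_addSl.
case/subsetPn => _ /addSP[e [b0 [Ae Bb0 ->]]] notAeb.
pose A1 := A :|: [set b + e | b in B].
pose B1 := [set b in B | b + e \in A].
have A10 : 0 \in A1 by rewrite inE A0.
have B10 : 0 \in B1 by rewrite inE B0 add0r.
have B1B : B1 \proper B.
  apply/properP; split; first by apply/subsetP => b; rewrite inE => /andP[].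
  by exists b0 => //; rewrite inE Bb0 addrC.
have cardAB : (#|A1| + #|B1| = #|A| + #|B|)%N.
  rewrite cardsU card_translate.
  have -> : A :&: [set b + e | b in B] = [set b + e | b in B1].
    apply/setP => g; rewrite inE; apply/andP/imsetP.
      by case=> Ag /imsetP[b Bb eg]; exists b => //; rewrite inE Bb -eg.
    by case=> b; rewrite inE => /andP[Bb Abe] ->; split => //; apply: imset_f.
  rewrite card_translate subnK // (leq_trans (subset_leq_card (proper_sub B1B))) //.
  by rewrite leq_addl.
have [|A' [B' [[A'0 B'0] eqc A'sub st uniq]]] := IHn A1 B1 _ A10 B10.
  exact: leq_trans (proper_card B1B) _.
exists A', B'; split => //; first by rewrite eqc.
  apply: subset_trans A'sub _; apply/subsetP => _ /addSP[a [b [A1a B1b ->]]].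
  move: B1b; rewrite inE => /andP[Bb Abe].
  case/setUP: A1a => [Aa|/imsetP[b' Bb' ->]]; first exact: mem_addS.
  by rewrite -addrA addrC [e + b]addrC mem_addS.
(* For a new element b + e, the condition puts -b in A against b in B, so b = 0; then -e lies in B
   and e = 0 as well. *)
move=> uniqAB; apply: uniq => a /setUP[Aa|/imsetP[b Bb ->]].
  by rewrite inE => /andP[Ba _]; apply: uniqAB.
rewrite inE opprD addrNK => /andP[Bbe Ab].
have b_0 : b = 0 by apply: oppr_inj; rewrite oppr0; apply: uniqAB; rewrite ?opprK.
by move: Bbe; rewrite b_0 oppr0 !add0r => /(uniqAB e Ae).
Qed.

Lemma addS_sub_mulrn A B b m : 0 \in A -> addS A B \subset A -> b \in B ->
  b *+ m \in A.
Proof.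
move=> A0 /subsetP st Bb; elim: m => [|m IHm]; first by rewrite mulr0n.
by rewrite mulrSr st // mem_addS.
Qed.

(* Kemperman-Scherk *)
Lemma leq_card_addS_uniq0 A B : 0 \in A -> 0 \in B ->
  (forall a, a \in A -> - a \in B -> a = 0) ->
  (#|A| + #|B| <= #|addS A B| + 1)%N.
Proof.
move=> A0 B0 uniqAB.
have [A' [B' [[A'0 B'0] <- sub st /(_ uniqAB) uniq']]] := Dyson_transform A0 B0.
(* A' is stable under translation by B', so it contains every multiple of b in B', in particular -b;
   unique representation then forces b = 0. *)
suff /eqP-> : B' == [set 0] by rewrite cards1 leq_add2r subset_leq_card.
rewrite eqEsubset sub1set B'0 andbT; apply/subsetP => b B'b; rewrite inE.
have : - b \in A'.
  have -> : - b = b *+ #[b]%g.-1.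
    apply/eqP; rewrite eq_sym -subr_eq0 opprK -mulrSr prednK ?order_gt0 //.
    by apply/eqP; apply: (expg_order b).
  exact: (addS_sub_mulrn _ A'0 st).
by move=> /uniq'; rewrite opprK => /(_ B'b)/eqP; rewrite oppr_eq0.
Qed.

(** After translating both sets to contain 0, the transform ends either with B' trivial, and the
    sizes give the bound, or with a nonzero c in B', whose multiples lie in A' and fill a group of
    prime order. *)
Lemma Cauchy_Davenport A B : prime #|G| -> A != set0 -> B != set0 ->
  (minn #|G| (#|A| + #|B| - 1) <= #|addS A B|)%N.
Proof.
move=> prG /set0Pn[a Aa] /set0Pn[b Bb].
pose A0 := [set x - a | x in A]; pose B0 := [set x - b | x in B].
have A00 : 0 \in A0 by apply/imsetP; exists a; rewrite ?subrr.
have B00 : 0 \in B0 by apply/imsetP; exists b; rewrite ?subrr.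
have -> : #|addS A B| = #|addS A0 B0|.
  rewrite -(card_translate (addS A B) (- (a + b))); congr #|pred_of_set _|.
  apply/setP => g; apply/imsetP/addSP.
    case=> _ /addSP[x [y [Ax By ->]]] ->; exists (x - a), (y - b).
    by split; [apply: imset_f | apply: imset_f | rewrite opprD addrACA].
  case=> _ [_ [/imsetP[x Ax ->] /imsetP[y By ->] ->]]; exists (x + y).
    exact: mem_addS.
  by rewrite opprD addrACA.
have <- : #|A0| = #|A| by apply: card_translate.
have <- : #|B0| = #|B| by apply: card_translate.
have [A' [B' [[A'0 B'0] <- sub st _]]] := Dyson_transform A00 B00.
have [B'_0|/subsetPn[c B'c]] := boolP (B' \subset [set 0]).
  have -> : B' = [set 0] by apply/eqP; rewrite eqEsubset B'_0 sub1set.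
  by rewrite cards1 addnK (leq_trans (geq_minr _ _)) // subset_leq_card.
rewrite inE => c0; have A'c m := addS_sub_mulrn m A'0 st B'c.
apply: leq_trans (geq_minl _ _) (leq_trans _ (subset_leq_card sub)).
have <- : #[c]%g = #|G|.
  have /primeP[_ /(_ #[c]%g)] := prG.
  rewrite -cardsT cardSg ?subsetT // order_eq1 => /(_ isT)/orP[|/eqP//].
  by move=> /eqP c1; case/eqP: c0.
by apply/subset_leq_card/subsetP => _ /cycleP[m ->]; apply: A'c.
Qed.

End Sumsets.

(** * Growth of a set under translation *)

Section Growth.
Variable G : finZmodType.
Implicit Types (A B C P X S T U : {set G}) (H : {group G}) (a b g x y : G).

(** Its size is |(X + y) \ X|, Olson's function of y, which is even and subadditive. *)
Definition exits X y : {set G} := [set g in X | g + y \notin X].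
Arguments exits X%_set_scope y%_ring_scope.

Lemma exitsD X y z : (#|exits X (y + z)| <= #|exits X y| + #|exits X z|)%N.
Proof.
rewrite -(card_translate (exits X y) y).
rewrite -(card_translate (exits X (y + z)) y).
apply: leq_trans (leq_card_setU _ _); apply/subset_leq_card/subsetP => g.
case/imsetP=> x; rewrite inE => /andP[Xx xyz] ->; rewrite inE.
have [Xxy|notXxy] := boolP (x + y \in X).
  by apply/orP; right; rewrite inE Xxy -addrA.
by apply/orP; left; apply: imset_f; rewrite inE Xx.
Qed.

Lemma exits0 X : exits X 0 = set0.
Proof. by apply/setP => g; rewrite !inE addr0 andbN. Qed.

Lemma card_exitsC X y :
  (#|exits X y| + #|[set g in X | (g + y)%R \in X]| = #|X|)%N.
Proof.
rewrite addnC -(cardsID [set g | g + y \in X] X).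
by congr (_ + _)%N; apply: eq_card => g; rewrite !inE // andbC.
Qed.

Lemma card_exitsN X y : #|exits X (- y)| = #|exits X y|.
Proof.
apply: (@addIn #|[set g in X | (g + y)%R \in X]|); rewrite card_exitsC.
rewrite -(card_exitsC X (- y)); congr (_ + _)%N.
rewrite -(card_translate [set g in X | g + y \in X] y); apply: eq_card => g.
apply/imsetP/idP; rewrite !inE.
  by case=> x; rewrite inE => /andP[Xx Xxy] ->; rewrite addrK Xx Xxy.
by move=> /andP[Xg Xgy]; exists (g - y); rewrite ?inE subrK ?Xg ?Xgy.
Qed.

(** Allows a set larger than half of H to be replaced by its complement, since [exists_exits]
    requires at most half. *)
Lemma card_exits_setD H X y : X \subset H -> y \in H ->
  #|exits (H :\: X) y| = #|exits X y|.
Proof.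
move=> /subsetP XH Hy; have Hny : - y \in H by apply: groupVr.
rewrite -(card_exitsN X) -(card_translate (exits _ y) y); apply: eq_card => g.
apply/imsetP/idP; rewrite !inE.
  case=> x; rewrite !inE => /andP[/andP[notXx Hx]].
  by rewrite [(x + y) \in H](groupM Hx Hy) andbT negbK => Xxy ->; rewrite addrK Xxy.
move=> /andP[Xg notXgy]; exists (g - y); rewrite ?subrK // !inE subrK notXgy Xg /=.
by rewrite [_ \in H](groupM (XH g Xg) Hny).
Qed.

(** Counts the pairs of y in P and x in X with x + y in X: each x accounts for at most |X| of
    them. *)
Lemma leq_card_mul_exits X P D : (forall y, y \in P -> #|exits X y| <= D)%N ->
  (#|P| * #|X| <= #|P| * D + #|X| * #|X|)%N.
Proof.
move=> leD; rewrite -[X in (X <= _)%N]sum_nat_const.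
under eq_bigr => y _ do rewrite -(card_exitsC X y).
rewrite big_split leq_add //=; first by rewrite -sum_nat_const leq_sum.
pose F x := #|[set y in P | (x + y)%R \in X]|.
have -> : (\sum_(y in P) #|[set g in X | (g + y)%R \in X]| = \sum_(x in X) F x)%N.
  under eq_bigr => y _ do rewrite -sum1dep_card big_mkcondr.
  rewrite exchange_big; apply: eq_bigr => x _.
  by rewrite /F -sum1dep_card big_mkcondr.
rewrite -sum_nat_const leq_sum // => x _.
rewrite /F -(card_imset _ (addrI x)); apply/subset_leq_card/subsetP => _ /imsetP[y Py ->].
by move: Py; rewrite inE => /andP[].
Qed.

Definition nfold T j : {set G} := iter j (addS T) [set 0].

Arguments nfold T%_set_scope j%_nat_scope : simpl never.

Lemma nfoldD T i j : nfold T (i + j) = addS (nfold T i) (nfold T j).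
Proof.
elim: i => [|i IHi]; first by rewrite add0S.
by rewrite /nfold /= -!/(nfold _ _) IHi addSA.
Qed.

Lemma nfold1 T : nfold T 1 = T.
Proof. by rewrite /nfold /= addSC add0S. Qed.

Lemma nfoldSr T j : nfold T j.+1 = addS (nfold T j) T.
Proof. by rewrite -addn1 nfoldD nfold1. Qed.

Lemma nfold_mono T i j : 0 \in T -> (i <= j)%N -> nfold T i \subset nfold T j.
Proof.
move=> T0 leij; rewrite -(subnK leij); elim: (j - i)%N => // m IHm.
apply: subset_trans IHm _; rewrite addSn nfoldSr.
exact: subset_addSl.
Qed.

Lemma nfold_stable T j : 0 \in T -> nfold T j.+1 \subset nfold T j ->
  forall i, nfold T i \subset nfold T j.
Proof.
move=> T0 st; elim=> [|i IHi]; first exact: nfold_mono.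
apply: subset_trans _ st; rewrite !nfoldSr.
exact: addSS.
Qed.

Lemma gen_sub_nfold_stable T j : 0 \in T -> nfold T j.+1 \subset nfold T j ->
  <<T>>%g \subset nfold T j.
Proof.
move=> T0 st; have [n ->] := gen_expgs T.
have -> : (1 |: T)%g = T by apply/setUidPr; rewrite sub1set.
apply: subset_trans (nfold_stable T0 st n); elim: n => [|n IHn].
  by rewrite expg0.
rewrite expgS; apply/subsetP => _ /mulsgP[x y Tx xny ->].
by apply: (@mem_addS _ _ _ x y); rewrite ?(subsetP IHn).
Qed.

(* If z lies in the (3i+2)-fold but not in the (3i+1)-fold sumset, then z + T *)
(* lies in the (3i+3)-fold sumset and, T being symmetric, misses the 3i-fold. *)
Lemma leq_card_nfold T i : 0 \in T -> (forall t, t \in T -> - t \in T) ->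
  (minn (i * #|T|) #|<<T>>%g| <= #|nfold T (3 * i)|)%N.
Proof.
move=> T0 Tsym; elim: i => [|i IHi]; first by rewrite mul0n min0n.
have [st|] := boolP (nfold T (3 * i).+2 \subset nfold T (3 * i).+1).
  apply: leq_trans (geq_minr _ _) (subset_leq_card _).
  apply: subset_trans (gen_sub_nfold_stable T0 st) (nfold_mono T0 _); lia.
case/subsetPn => z z2 notz1.
have dis : [disjoint nfold T (3 * i) & [set t + z | t in T]].
  rewrite disjoint_sym; apply/pred0P => g /=.
  apply/negP => /andP[/imsetP[t Tt ->]] tz.
  case/negP: notz1; rewrite nfoldSr.
  by rewrite -[z](addKr t) addrC mem_addS // Tsym.
have sub : nfold T (3 * i) :|: [set t + z | t in T] \subset nfold T (3 * i.+1).
  rewrite subUset nfold_mono ?leq_pmul2l ?leqnSn // andTb.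
  apply/subsetP => _ /imsetP[t Tt ->].
  have -> : (3 * i.+1 = 1 + (3 * i).+2)%N by lia.
  by rewrite nfoldD nfold1 mem_addS.
have := subset_leq_card sub; rewrite cardsU disjoint_setI0 // cards0 subn0.
rewrite card_translate; lia.
Qed.

Lemma card_exits_nfold X T D j : (forall y, y \in T -> #|exits X y| <= D)%N ->
  forall y, y \in nfold T j -> (#|exits X y| <= j * D)%N.
Proof.
move=> leD; elim: j => [|j IHj] y.
  by rewrite inE => /eqP->; rewrite exits0 cards0.
case/addSP => a [b [Ta jb ->]]; rewrite mulSn.
by apply: leq_trans (exitsD _ _ _) (leq_add _ _); [apply: leD|apply: IHj].
Qed.

(* Olson: if all x in S move X by at most D, then all of (3i)T move it by at *)
(* most 3iD for T = S U -S U {0}; with i|T| close to 2|X|, averaging over    *)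
(* (3i)T gives 6iD >= |X|.                                                   *)
Lemma exists_exits S X : X \subset <<S>>%g -> X != set0 ->
  (2 * #|X| <= #|<<S>>%g|)%N ->
  exists2 x, x \in S & (#|S| <= 24 * #|exits X x|)%N || (#|X| <= 12 * #|exits X x|)%N.
Proof.
move=> XS X0 le2X; apply/exists_inP/contraT; rewrite negb_exists_in.
move=> /forall_inP small.
pose T := 0 |: (S :|: [set - x | x in S]).
have T0 : 0 \in T by rewrite setU11.
have Tsym t : t \in T -> - t \in T.
  rewrite !inE oppr_eq0 => /or3P[->//|St|/imsetP[x Sx ->]].
    by rewrite imset_f ?orbT.
  by rewrite opprK Sx orbT.
have ST : S \subset T by apply/subsetP => x Sx; rewrite !inE Sx orbT.
have TS : <<S>>%g \subset <<T>>%g by rewrite genS.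
pose D := (\max_(x in S) #|exits X x|)%N.
have Dsmall : (24 * D < #|T| /\ 12 * D < #|X|)%N.
  have [->|[x Sx ->]] : D = 0%N \/ exists2 x, x \in S & D = #|exits X x|.
  - have [S0|[x Sx]] := set_0Vmem S; first by left; rewrite /D S0 big_set0.
    right; case: (eq_bigmax_cond (fun x => #|exits X x|) (_ : 0 < #|S|)%N).
      by apply/card_gt0P; exists x.
    by move=> y Sy eqD; exists y.
  - by rewrite muln0 !card_gt0 X0; split => //; apply/set0Pn; exists 0.
  have := small x Sx; rewrite negb_or -!ltnNge => /andP[ltS ltX]; split => //.
  exact: leq_trans ltS (subset_leq_card ST).
have leD y : y \in T -> (#|exits X y| <= D)%N.
  rewrite !inE => /or3P[/eqP->|Sy|/imsetP[x Sx ->]].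
  - by rewrite exits0 cards0.
  - exact: (@leq_bigmax_cond _ (mem S) (fun x => #|exits X x|) _ Sy).
  - by rewrite card_exitsN; apply: (@leq_bigmax_cond _ (mem S) (fun x => #|exits X x|) _ Sx).
have T_gt0 : (0 < #|T|)%N by apply/card_gt0P; exists 0.
have X_gt0 : (0 < #|X|)%N by rewrite card_gt0.
pose i := (2 * #|X| %/ #|T|).+1.
have lei : (2 * #|X| <= i * #|T|)%N by apply: ltnW; apply: ltn_ceil.
have gei : (i * #|T| <= 2 * #|X| + #|T|)%N by rewrite mulSn addnC leq_add // leq_divM.
have := leq_card_nfold i T0 Tsym.
have := leq_card_mul_exits (card_exits_nfold (j := (3 * i)%N) leD).
move: (subset_leq_card TS) => leST.
set P := #|nfold _ _| => ineq leP.
have le2P : (2 * #|X| <= P)%N.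
  by apply: leq_trans _ leP; rewrite leq_min lei; apply: leq_trans le2X leST.
(* As P is at least 2|X|, the term |X|^2 absorbs at most half of P|X|, which leaves |X| / 2 <=
   3iD. *)
have le6iD : (#|X| <= 2 * (3 * i * D))%N.
  rewrite leqNgt; apply/negP => lt6iD.
  have : (#|X| * (2 * #|X|) <= #|X| * P)%N by rewrite leq_mul2l le2P orbT.
  have : (P * (2 * (3 * i * D)).+1 <= P * #|X|)%N by rewrite leq_mul2l lt6iD orbT.
  move: ineq; set Z := (3 * i * D)%N; nia.
have [ltD ltD'] := Dsmall.
(* The estimates combine to |X||T| <= 12D|X| + 6D|T|, but 24D < |T| and 12D < |X| make each term
   less than half of |X||T|. *)
have : (#|X| * #|T| <= 6 * D * (i * #|T|))%N.
  by apply: leq_trans (leq_mul le6iD (leqnn _)) _; lia.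
have : (6 * D * (i * #|T|) <= 6 * D * (2 * #|X| + #|T|))%N by rewrite leq_mul2l gei orbT.
have : (24 * D * #|X| < #|T| * #|X|)%N by rewrite ltn_pmul2r.
have : (12 * D * #|T| < #|X| * #|T|)%N by rewrite ltn_pmul2r.
nia.
Qed.

End Growth.

(** * Subset sums of zero-sum free sequences *)

Section ZeroSumFree.
Variable G : finZmodType.
Implicit Types (A B C U : {set G}) (H : {group G}) (a g x : G) (s t : seq G).

Definition ssum s : {set G} := \big[@addS G/[set 0]]_(a <- s) [set 0; a].

Lemma ssum_cat s t : ssum (s ++ t) = addS (ssum s) (ssum t).
Proof. exact: big_cat. Qed.

Lemma ssum_perm s t : perm_eq s t -> ssum s = ssum t.
Proof. exact: perm_big. Qed.

Lemma ssum_cons a s : ssum (a :: s) = ssum s :|: [set g + a | g in ssum s].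
Proof.
rewrite /ssum big_cons; apply/setP => g; rewrite inE; apply/addSP/orP.
  case=> _ [b [/set2P[]-> sb ->]]; first by left; rewrite add0r.
  by right; apply/imsetP; exists b; rewrite // addrC.
case=> [sg|/imsetP[b sb ->]]; first by exists 0, g; rewrite set21 add0r.
by exists a, b; rewrite set22 addrC.
Qed.

Lemma card_ssum_cons a s : #|ssum (a :: s)| = (#|ssum s| + #|exits (ssum s) a|)%N.
Proof.
set B := ssum s.
have -> : ssum (a :: s) = B :|: [set g + a | g in exits B a].
  rewrite ssum_cons -/B; apply/setP => g; rewrite !in_setU.
  have [//|notBg] := boolP (g \in B); apply/imsetP/imsetP => -[x Bx eg].
    by exists x; rewrite // inE Bx -eg.
  by exists x => //; move: Bx; rewrite inE => /andP[].
rewrite cardsU card_translate; set I := _ :&: _; suff -> : I = set0 by rewrite cards0 subn0.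
apply/setP => g; rewrite !inE; apply/andP => -[Bg /imsetP[x]].
by rewrite inE => /andP[_ /negP+ eg]; rewrite -eg.
Qed.

Lemma ssumP s g :
  reflect (exists t t', perm_eq s (t ++ t') /\ \sum_(a <- t) a = g) (g \in ssum s).
Proof.
elim: s g => [|b s IHs] g.
  rewrite /ssum big_nil; apply: (iffP set1P) => [->|[t [t' [/perm_size]]]].
    by exists [::], [::]; rewrite big_nil.
  by case: t => //= _ <-; rewrite big_nil.
rewrite ssum_cons inE; apply: (iffP orP).
  case=> [/IHs[t [t' [st <-]]]|/imsetP[_ /IHs[t [t' [st <-]]] ->]].
    by exists t, (b :: t'); rewrite perm_sym -cat1s perm_catCA perm_cons perm_sym.
  by exists (b :: t), t'; rewrite cat_cons perm_cons big_cons addrC.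
case=> t [t' [st <-]].
have : b \in t ++ t' by rewrite -(perm_mem st) mem_head.
rewrite mem_cat => /orP[tb|tb].
  right; apply/imsetP; exists (\sum_(a <- rem b t) a).
    apply/IHs; exists (rem b t), t'; split => //.
    rewrite -(perm_cons b) (permPl st) -cat_cons perm_cat2r.
    exact: perm_to_rem.
  by rewrite (perm_big _ (perm_to_rem tb)) big_cons addrC.
left; apply/IHs; exists t, (rem b t'); split => //.
rewrite -(perm_cons b) (permPl st) perm_sym -cat1s perm_catCA perm_cat2l.
by rewrite perm_sym; apply: perm_to_rem.
Qed.

Lemma ssum0 s : 0 \in ssum s.
Proof. by apply/ssumP; exists [::], s; rewrite big_nil. Qed.

Lemma ssum_sub_group H s : {subset s <= H} -> ssum s \subset H.
Proof.
move=> sH; apply/subsetP => _ /ssumP[t [t' [st <-]]].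
have : {subset t <= H} by move=> x tx; rewrite sH // (perm_mem st) mem_cat tx.
elim: t {st} => [|x t IHt] tH; first by rewrite big_nil (group1 H).
rewrite big_cons; apply: (@groupM _ H); first by rewrite tH ?mem_head.
by apply: IHt => y ty; rewrite tH // inE ty orbT.
Qed.

Definition zero_sum_free s :=
  forall t t', perm_eq s (t ++ t') -> \sum_(a <- t) a = 0 -> t = [::].

Lemma zero_sum_free_perm s t : perm_eq s t -> zero_sum_free s -> zero_sum_free t.
Proof. by move=> st zs u u' tu; apply: zs (perm_trans st tu). Qed.

Lemma zero_sum_free_catl s t : zero_sum_free (s ++ t) -> zero_sum_free s.
Proof. by move=> zs u u' su; apply: (zs u (u' ++ t)); rewrite catA perm_cat2r. Qed.

Lemma zero_sum_free_catr s t : zero_sum_free (s ++ t) -> zero_sum_free t.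
Proof.
by move=> /(@zero_sum_free_perm _ (t ++ s)) zs; apply: zero_sum_free_catl (zs _); rewrite perm_catC.
Qed.

(** Subsequences of s and t with opposite sums join to a zero-sum subsequence, hence are empty. This
    provides the hypothesis of Kemperman-Scherk. *)
Lemma zero_sum_free_uniq0 s t : zero_sum_free (s ++ t) ->
  forall a, a \in ssum s -> - a \in ssum t -> a = 0.
Proof.
move=> zst a /ssumP[u [u' [su <-]]] /ssumP[v [v' [tv eqv]]].
have : u ++ v = [::].
  apply: (zst _ (u' ++ v')); last by rewrite big_cat /= eqv subrr.
  by rewrite perm_sym perm_catACA perm_cat // perm_sym.
by case: u su eqv => // _ _ _; rewrite big_nil.
Qed.

Lemma leq_card_ssum_cat s t : zero_sum_free (s ++ t) ->
  (#|ssum s| + #|ssum t| <= #|ssum (s ++ t)| + 1)%N.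
Proof.
move=> zst; rewrite ssum_cat leq_card_addS_uniq0 ?ssum0 //.
exact: zero_sum_free_uniq0.
Qed.

Lemma mem_ssum s x : x \in s -> x \in ssum s.
Proof.
by move=> sx; apply/ssumP; exists [:: x], (rem x s); rewrite big_seq1 perm_to_rem.
Qed.

Lemma zero_sum_free_neq0 s x : zero_sum_free s -> x \in s -> x != 0.
Proof.
move=> zs sx; apply/eqP => x0; have := zs [:: x] (rem x s) (perm_to_rem sx).
by rewrite big_seq1 => /(_ x0).
Qed.

Lemma perm_enum_setU1 U x : x \notin U -> perm_eq (enum (x |: U)) (x :: enum U).
Proof.
move=> notUx; apply: uniq_perm; rewrite /= ?enum_uniq ?mem_enum ?notUx //.
by move=> y; rewrite inE !mem_enum !inE.
Qed.

Lemma perm_enum_setD A U : U \subset A -> perm_eq (enum A) (enum U ++ enum (A :\: U)).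
Proof.
move=> /subsetP UA; apply: uniq_perm; rewrite ?enum_uniq //.
  rewrite cat_uniq !enum_uniq andbT; apply/hasPn => y.
  by rewrite /= !mem_enum inE => /andP[].
move=> y; rewrite mem_cat !mem_enum inE; have [/UA->|] := boolP (y \in U) => //.
Qed.

(** S = A \ U keeps at least 3/4 of A, so it generates a subgroup containing A. Applying
    [exists_exits] to the subset sums B of U, or to their complement in [<<S>>] if B exceeds half of
    it, gives an element that adds at least (2u + 1) / 24 new sums; these increments add up to u^2 /
    24. *)
Lemma greedy_ssum A u : zero_sum_free (enum A) ->
    (forall H, (3 * #|A| <= 4 * #|A :&: H|)%N -> A \subset H) ->
    (4 * u <= #|A|)%N ->
  exists U, [/\ U \subset A, #|U| = u, (u < #|ssum (enum U)|)%N
             & (u ^ 2 + 24 <= 24 * #|ssum (enum U)|)%N].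
Proof.
move=> zsA spanA; elim: u => [|u IHu] le4u.
  by exists set0; rewrite enum_set0 /ssum big_nil cards1 cards0 sub0set.
have [|U [UA cardU ltuB leuB]] := IHu; first lia.
pose S := A :\: U; set B := ssum (enum U) in ltuB leuB.
have cardS : (#|S| + u = #|A|)%N.
  by rewrite -cardU cardsD (setIidPr UA) subnK // subset_leq_card.
have AS : A \subset <<S>>%g.
  apply: (spanA <<S>>%G); apply: (@leq_trans (4 * #|S|)); first lia.
  rewrite leq_mul2l /=; apply/subset_leq_card; rewrite subsetI subsetDl /=.
  exact: subset_gen.
have BS : B \subset <<S>>%g.
  by apply: ssum_sub_group => x; rewrite mem_enum => /(subsetP UA)/(subsetP AS).
have zsUS : zero_sum_free (enum U ++ enum S).
  exact: zero_sum_free_perm (perm_enum_setD UA) zsA.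
pose C : {set G} := <<S>>%g :\: B.
(* Zero-sum freeness keeps -x out of B for every x in S. *)
have leSC : (#|S| <= #|C|)%N.
  rewrite -(card_imset _ (@oppr_inj G)); apply/subset_leq_card/subsetP.
  move=> _ /imsetP[x Sx ->]; have Hx : x \in <<S>>%g by rewrite mem_gen.
  have HNx : - x \in <<S>>%g by rewrite (@groupVr _ <<S>>%G).
  rewrite inE HNx andbT; apply/negP => BNx.
  have := zero_sum_free_uniq0 zsUS BNx; rewrite opprK mem_ssum ?mem_enum //.
  move=> /(_ isT)/eqP; rewrite oppr_eq0; apply/negP.
  apply: (@zero_sum_free_neq0 (enum A)) => //; rewrite mem_enum.
  by move: Sx; rewrite inE => /andP[].
have [x Sx grow] : exists2 x, x \in S & (2 * u + 1 <= 24 * #|exits B x|)%N.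
  have H_eq : (#|B| + #|C| = #|<<S>>%g|)%N.
    by rewrite cardsD (setIidPr BS) subnKC // subset_leq_card.
  have [le2B|lt2B] := leqP (2 * #|B|) #|<<S>>%g|.
    have [|x Sx grow] := exists_exits BS _ le2B.
      by rewrite -card_gt0; apply: leq_trans ltuB.
    by exists x => //; case/orP: grow => grow; lia.
  have [|||x Sx grow] := @exists_exits _ S C.
  - exact: subsetDl.
  - by rewrite -card_gt0; apply: leq_trans leSC; lia.
  - by rewrite -H_eq in lt2B *; lia.
  have Hx : x \in <<S>>%g by rewrite mem_gen.
  exists x => //; rewrite (@card_exits_setD _ <<S>>%G) // in grow.
  by case/orP: grow => grow; lia.
have notUx : x \notin U by move: Sx; rewrite inE => /andP[].
have eqB : #|ssum (enum (x |: U))| = (#|B| + #|exits B x|)%N.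
  by rewrite (ssum_perm (perm_enum_setU1 notUx)) card_ssum_cons.
exists (x |: U); rewrite eqB cardsU1 notUx cardU; split => //.
- by rewrite subUset UA sub1set andbT; move: Sx; rewrite inE => /andP[].
- by clear -ltuB grow; lia.
- by clear -ltuB leuB grow; nia.
Qed.

Lemma leq_sqr_card_ssum A : zero_sum_free (enum A) ->
  (#|A| ^ 2 <= 672 * #|ssum (enum A)|)%N.
Proof.
have [n] := ubnP #|A|; elim: n A => // n IHn A leAn zsA.
case: (boolP [exists H : {group G}, (3 * #|A| <= 4 * #|A :&: H|)%N && ~~ (A \subset H)]).
  case/existsP => H /andP[le34 /subsetPn[x Ax notHx]].
  have A1A : A :&: H \subset A := subsetIl A H.
  have notA1x : x \notin A :&: H by rewrite inE negb_and notHx orbT.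
  have ltA1 : (#|A :&: H| < #|A|)%N.
    by apply: proper_card; apply/properP; split => //; exists x.
  have zsA1 : zero_sum_free (enum (A :&: H)).
    exact: zero_sum_free_catl (zero_sum_free_perm (perm_enum_setD A1A) zsA).
  have := IHn _ (leq_trans ltA1 _) zsA1; rewrite -ltnS => /(_ leAn) IHA1.
  set B := ssum (enum (A :&: H)) in IHA1.
  have BH : B \subset H.
    by apply: ssum_sub_group => y; rewrite mem_enum inE => /andP[].
  have xA1A : x |: A :&: H \subset A by rewrite subUset sub1set Ax.
  (* The sums of [A :&: H] and their translates by x lie in different cosets of H. Induction closes
     because |A|^2 is at most 16/9 of the square of the size of [A :&: H]. *)
  have : (2 * #|B| <= #|ssum (enum A)|)%N.
    apply: (@leq_trans #|ssum (enum (x |: A :&: H))|).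
      rewrite (ssum_perm (perm_enum_setU1 notA1x)) card_ssum_cons -/B.
      rewrite mul2n -addnn leq_add2l subset_leq_card //; apply/subsetP => g Bg.
      rewrite inE Bg /=; apply: contra notHx => /(subsetP BH) Hgx.
      by rewrite -(groupMl x (subsetP BH g Bg)).
    apply: subset_leq_card; rewrite (ssum_perm (perm_enum_setD xA1A)) ssum_cat.
    by rewrite subset_addSl ?ssum0.
  move: IHA1 le34; set a := #|A :&: H|; set b := #|A|; nia.
rewrite negb_exists => /forallP spanA.
have [||U [UA _ _ leU]] := @greedy_ssum A (#|A| %/ 4) zsA.
- by move=> H le34; have := spanA H; rewrite le34 /= negbK.
- by rewrite mulnC leq_divM.
have : (#|ssum (enum U)| <= #|ssum (enum A)|)%N.
  apply: subset_leq_card; rewrite (ssum_perm (perm_enum_setD UA)) ssum_cat.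
  by rewrite subset_addSl ?ssum0.
have := ltn_ceil #|A| (isT : 0 < 4)%N.
move: leU; move: (#|A| %/ 4)%N => u leU ltA leS.
(* The constant works since (4u + 3)^2 <= 28 (u^2 + 24) and 672 = 28 * 24. *)
have : (#|A| ^ 2 <= (4 * u + 3) ^ 2)%N by rewrite leq_sqr; lia.
move: leU leS; rewrite -!mulnn; nia.
Qed.

(* Induction on k: remove one copy of each element and apply Kemperman-Scherk *)
(* together with (a + r)^2 <= (k + 1)(a^2 + r^2 / k).                         *)
Lemma leq_sqr_size_ssum k s : zero_sum_free s ->
    (forall a, count_mem a s <= k)%N ->
  (size s ^ 2 <= 1344 * k * (#|ssum s| - 1))%N.
Proof.
elim: k s => [|k IHk] s zss les.
  by case: s zss les => // a s _ /(_ a); rewrite /= eqxx.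
have [r sr] := perm_to_subseq (undup_subseq s).
pose A := [set a in s].
have perA : perm_eq (enum A) (undup s).
  apply: uniq_perm; rewrite ?enum_uniq ?undup_uniq // => x.
  by rewrite mem_enum inE mem_undup.
have zsur := zero_sum_free_perm sr zss.
have zsA : zero_sum_free (enum A).
  by apply: zero_sum_free_perm (zero_sum_free_catl zsur); rewrite perm_sym.
have := leq_sqr_card_ssum zsA; rewrite cardE (perm_size perA) (ssum_perm perA) => leA.
have ler a : (count_mem a r <= k)%N.
  have := les a; rewrite (seq.permP sr) count_cat count_uniq_mem ?undup_uniq // mem_undup.
  case: (boolP (a \in s)) => // /count_memPn; rewrite (seq.permP sr) count_cat => /eqP.
  by rewrite addn_eq0 => /andP[_ /eqP->].
have := IHk r (zero_sum_free_catr zsur) ler.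
have := leq_card_ssum_cat zsur.
rewrite -(ssum_perm sr) (perm_size sr) size_cat => leSum leR.
have gt1 : (size (undup s) = 0 \/ 1 < #|ssum (undup s)|)%N.
  case us: (undup s) => [|x u]; [by left|right].
  have neq0 : x != 0 by apply: zero_sum_free_neq0 zss _; rewrite -mem_undup us mem_head.
  rewrite -us; apply: (@leq_trans #|[set 0; x]|); first by rewrite cards2 eq_sym neq0.
  apply/subset_leq_card; rewrite subUset !sub1set ssum0 mem_ssum //.
  by rewrite us mem_head.
have pos t : (0 < #|ssum t|)%N by apply/card_gt0P; exists 0; apply: ssum0.
have [u0 r0] := (pos (undup s), pos r).
have r_k : k = 0%N -> size r = 0%N.
  move=> k0; case: (r) ler => // x r'; rewrite k0 => /(_ x); by rewrite /= eqxx.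
move: leA leR leSum gt1 u0 r0 r_k.
set a := size (undup s); set b := size r.
set x := #|_|; set y := #|_|; set z := #|_|.
move=> leA leR leSum gt1 u0 r0 r_k.
case: (posnP k) => [k0|k_gt0].
  move: leR leSum leA; rewrite (r_k k0) k0 addn0 muln1 => _.
  by case: gt1 => [->|gt1]; nia.
(* Unless a = 0 there are x >= 2 subset sums, so 672 x <= 1344 (x - 1): discounting the sum 0
   doubles the constant. *)
have a_le : (a ^ 2 <= 1344 * (x - 1))%N by case: gt1 => [->|gt1]; nia.
have cs : (k * (a + b) ^ 2 <= k.+1 * (k * a ^ 2 + b ^ 2))%N.
  have := (nat_Cauchy (k * a) b).1; rewrite -!mulnn; nia.
rewrite -(leq_pmul2l k_gt0) (leq_trans cs) //.
have : (k * a ^ 2 + b ^ 2 <= k * (1344 * (z - 1)))%N.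
  have : (k * a ^ 2 <= k * (1344 * (x - 1)))%N by rewrite leq_mul2l a_le orbT.
  have le_z : (x - 1 + (y - 1) <= z - 1)%N by lia.
  have : (k * (1344 * (x - 1 + (y - 1))) <= k * (1344 * (z - 1)))%N.
    by rewrite !leq_mul2l le_z !orbT.
  nia.
move=> /(leq_mul (leqnn k.+1)); nia.
Qed.

End ZeroSumFree.

(** * Sums of k terms in a group of prime order *)

Lemma sum_count_mem (T : finType) (s : seq T) :
  (\sum_a count_mem a s = size s)%N.
Proof.
elim: s => [|x s IHs]; first by rewrite big1.
rewrite /= big_split /= IHs (bigD1 x) //= eqxx big1 ?addn0 // => a.
by rewrite eq_sym => /negbTE->.
Qed.

(* Split off the set of all elements of maximal multiplicity k + 1 (or a      *)
(* single element if there is none) and apply Cauchy-Davenport.               *)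
Lemma Cauchy_Davenport_subseq (G : finZmodType) k (s : seq G) : prime #|G| ->
    (forall a, count_mem a s <= k)%N -> (k <= size s)%N ->
  exists W : {set G}, (minn #|G| (size s - k + 1) <= #|W|)%N /\
    (forall g, g \in W ->
     exists t t', [/\ perm_eq s (t ++ t'), size t = k & \sum_(a <- t) a = g]).
Proof.
move=> prG; elim: k s => [|k IHk] s les leks.
  exists [set 0]; split; last first.
    by move=> g /set1P->; exists [::], s; rewrite big_nil.
  case: s les {leks} => [|a s /(_ a)]; last by rewrite /= eqxx.
  by rewrite cards1 geq_minr.
(* A must contain every element of multiplicity k + 1, so that multiplicities drop to k, and still
   leave k terms for the induction; the elements of maximal multiplicity number at most [size s] /
   (k + 1). *)
have [A [A0 As Amax leA]] : exists A : {set G}, [/\ A != set0, {subset A <= s},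
    (forall a, count_mem a s = k.+1 -> a \in A) & (k <= size s - #|A|)%N].
  have [] := set_0Vmem [set a | count_mem a s == k.+1].
    case: s les leks => [//|a s] les leks max0; exists [set a]; split.
    - by apply/set0Pn; exists a; rewrite set11.
    - by move=> x /set1P->; rewrite mem_head.
    - by move=> x /eqP xk; have /[!inE] : x \in set0 by rewrite -max0 inE.
    - by rewrite cards1 /= subn1.
  case=> x xk; exists [set a | count_mem a s == k.+1]; split.
  - by apply/set0Pn; exists x.
  - by move=> a; rewrite inE -has_pred1 has_count => /eqP->.
  - by move=> a /eqP; rewrite inE.
  set M := [set a | _] in xk *.
  have : (#|M| * k.+1 <= size s)%N.
    rewrite -sum_nat_const.
    apply: (@leq_trans (\sum_(a in M) count_mem a s)).
      by apply: leq_sum => a; rewrite inE => /eqP->.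
    by rewrite -(sum_count_mem s) big_mkcond leq_sum // => a _; case: ifP.
  have : (0 < #|M|)%N by apply/card_gt0P; exists x.
  move: #|M| => m; nia.
have [r sr] : exists r : seq G, perm_eq s (enum A ++ r).
  have [|t ts At] := (count_subseqP (enum A) s).1.
    move=> a; rewrite count_uniq_mem ?enum_uniq // mem_enum.
    by case: (boolP (a \in A)) => // /As; rewrite -has_pred1 has_count.
  have [r sr] := perm_to_subseq ts; exists r.
  by rewrite (permPl sr) perm_cat2r perm_sym.
have szs : size s = (#|A| + size (r : seq G))%N by rewrite (perm_size sr) size_cat -cardE.
have ler a : (count_mem a r <= k)%N.
  have := les a; rewrite leq_eqVlt ltnS => /orP[/eqP ak|].
    move: (ak); rewrite (seq.permP sr) count_cat count_uniq_mem ?enum_uniq //.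
    by rewrite mem_enum Amax // add1n => -[->].
  by apply: leq_trans; rewrite (seq.permP sr) count_cat leq_addl.
have [|W [leW Wsum]] := IHk r ler; first by rewrite szs addKn in leA.
have W0 : W != set0.
  rewrite -card_gt0; apply: leq_trans leW; rewrite leq_min addn1 andbT.
  exact: prime_gt0.
exists (addS A W); split.
  apply: leq_trans (Cauchy_Davenport prG A0 W0).
  have A_gt0 : (0 < #|A|)%N by rewrite card_gt0.
  lia.
move=> _ /addSP[a [b [Aa /Wsum[t [t' [rt szt sumt]]] ->]]].
exists (a :: t), (rem a (enum A) ++ t'); split; last first.
- by rewrite big_cons sumt.
- by rewrite /= szt.
rewrite (permPl sr) (perm_trans (perm_cat (perm_to_rem (_ : a \in enum A)) rt)) ?mem_enum //.
by rewrite !cat_cons perm_cons perm_catCA.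
Qed.

(** * Sequences in the integers modulo n *)

Section Bridge.
Variables (n m : nat).
Implicit Type x : m.-tuple 'Z_n.

Lemma perm_tuple_setP x (I : {set 'I_m}) :
  perm_eq x ([seq tnth x i | i <- enum I] ++ [seq tnth x i | i <- enum (~: I)]).
Proof.
rewrite -map_cat -[X in perm_eq X _](map_tnth_enum x) perm_map //.
apply: uniq_perm; rewrite ?enum_uniq // ?cat_uniq ?enum_uniq //=.
  by rewrite andbT; apply/hasPn => i; rewrite !mem_enum inE.
by move=> i; rewrite mem_cat !mem_enum !inE orbN.
Qed.

(** Replaces index sets of a tuple by splittings up to permutation, the form in which the sumset
    results are stated. *)
Lemma exists_setP x (c : nat) (g : 'Z_n) :
  (exists2 I : {set 'I_m}, #|I| = c & \sum_(i in I) tnth x i = g) <->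
  (exists t t', [/\ perm_eq x (t ++ t'), size t = c & \sum_(a <- t) a = g]).
Proof.
split=> [[I cI sumI]|[t [t' [xt sizet sumt]]]].
  exists [seq tnth x i | i <- enum I], [seq tnth x i | i <- enum (~: I)].
  by rewrite size_map -cardE big_map big_enum; split => //; apply: perm_tuple_setP.
have /tuple_permP[p tp] : perm_eq (t ++ t') x by rewrite perm_sym.
pose r := take c [seq p i | i <- enum 'I_m].
have r_uniq : uniq r by rewrite take_uniq // map_inj_uniq ?enum_uniq //; apply: perm_inj.
have tE : t = [seq tnth x i | i <- r].
  rewrite /r map_take -map_comp.
  have <- : t ++ t' = [seq tnth x (p i) | i <- enum 'I_m] by rewrite tp.
  by rewrite -sizet take_size_cat.
exists [set i in r].
  by rewrite cardsE (card_uniqP r_uniq) -sizet tE size_map.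
rewrite -sumt tE big_map big_uniq //=; apply: eq_bigl => i; exact: in_set.
Qed.

End Bridge.

Lemma erdosZP n m (x : m.-tuple 'Z_n) :
  reflect (exists t t', [/\ perm_eq x (t ++ t'), size t = n & \sum_(a <- t) a = 0])
          (erdosZ n x).
Proof.
apply: (iffP exists_inP) => [[I /eqP cI /eqP sI]|].
  by apply/exists_setP; exists I.
by move=> /exists_setP[I cI sI]; exists I; apply/eqP.
Qed.

Lemma davenportZP n m (x : m.-tuple 'Z_n) :
  reflect (exists t t', [/\ perm_eq x (t ++ t'), t != [::] & \sum_(a <- t) a = 0])
          (davenportZ n x).
Proof.
apply: (iffP exists_inP) => [[I I0 /eqP sI]|[t [t' [xt t0 sumt]]]].
  have [t [t' [xt szt sumt]]] : exists t t',
      [/\ perm_eq x (t ++ t'), size t = #|I| & \sum_(a <- t) a = 0].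
    by apply/exists_setP; exists I.
  exists t, t'; split => //; apply: contraNneq I0 => t0.
  by rewrite -cards_eq0 -szt t0.
have [I cI sI] : exists2 I : {set 'I_m}, #|I| = size t & \sum_(i in I) tnth x i = 0.
  by apply/exists_setP; exists t, t'.
exists I; last exact/eqP.
by rewrite -cards_eq0 cI size_eq0.
Qed.

Lemma s_inv_le n k m : (0 < m)%N ->
    (forall s : seq 'Z_n, size s = m -> (forall a, count_mem a s <= k)%N ->
     exists t t', [/\ perm_eq s (t ++ t'), size t = n & \sum_(a <- t) a = 0]) ->
  (s_inv k n <= m)%N.
Proof.
move=> m0 all_m; rewrite /s_inv; case: ex_minnP => i _; apply.
rewrite m0; apply/forall_inP => x; rewrite inE => /forallP x_le.
by apply/erdosZP; apply: all_m; rewrite ?size_tuple.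
Qed.

(** Prefixes inherit both properties of s, so no length up to [size s] qualifies. *)
Lemma s_inv_gt n k (s : seq 'Z_n) : (forall a, count_mem a s <= k)%N ->
    (forall t t', perm_eq s (t ++ t') -> size t = n -> \sum_(a <- t) a != 0) ->
  (size s < s_inv k n)%N.
Proof.
move=> les notE; rewrite /s_inv; case: ex_minnP => i /andP[_ /forall_inP all_i] _.
rewrite ltnNge; apply/negP => lei.
have sz : size (take i s) == i by rewrite size_takel.
have : Tuple sz \in Xseq k n i.
  rewrite inE; apply/forallP => a; apply: leq_trans (les a).
  by rewrite leq_count_subseq // take_subseq.
case/all_i/erdosZP => t [t' [/= st szt sumt]].
suff /notE/(_ szt) : perm_eq s (t ++ (t' ++ drop i s)) by rewrite sumt eqxx.
by rewrite catA -[X in perm_eq X _](cat_take_drop i) perm_cat2r.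
Qed.

(** * Multiplicity at most two *)

Lemma perm_pair_of_count (T : eqType) (s : seq T) a b :
    (forall c, count_mem c s <= 2)%N -> (2 < count_mem a s + count_mem b s)%N ->
  exists r, perm_eq s ([:: a; b] ++ r).
Proof.
move=> les lt2; have [|u us Pu] := (count_subseqP [:: a; b] s).1.
  move=> c /=; have := les a; have := les b.
  by case: (altP (a =P c)) => [<-|_]; case: (altP (b =P _)) => [eqb|_];
    move: lt2; rewrite ?eqb /=; lia.
have [r sr] := perm_to_subseq us.
by exists r; rewrite (permPl sr) perm_cat2r perm_sym.
Qed.

Lemma card_Zp_type n : (1 < n)%N -> #|'Z_n| = n.
Proof. by move=> n1; rewrite card_ord Zp_cast. Qed.

(** Summed over a, the multiplicities of a and g - a total 2(n + 2) > 2n, so some pair a, g - a can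
    be removed; the remaining n terms add up to 0. *)
Lemma s_inv2_le n : (1 < n)%N -> (s_inv 2 n <= n + 2)%N.
Proof.
move=> n_gt1; apply: s_inv_le => [|s sz les]; first by rewrite addn2.
pose g := \sum_(a <- s) a.
have [/existsP[a lt2]|] := boolP [exists a, (2 < count_mem a s + count_mem (g - a)%R s)%N].
  have [r pr] := perm_pair_of_count les lt2.
  exists r, [:: a; g - a]; rewrite (permPl pr) perm_catC; split => //.
    by have := perm_size pr; rewrite sz /=; lia.
  apply/(addrI g); rewrite addr0 {2}/g (perm_big _ pr) big_cat !big_cons big_nil /=.
  by rewrite addr0 [a + _]addrC subrK.
rewrite negb_exists => /forallP le2.
have : (\sum_(a : 'Z_n) (count_mem a s + count_mem (g - a)%R s) <= \sum_(a : 'Z_n) 2)%N.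
  by apply: leq_sum => a _; rewrite leqNgt.
rewrite big_split /= sum_count_mem sum_nat_const cardT -cardE card_Zp_type //.
rewrite (reindex_inj (subrI g)) /=; under eq_bigr do rewrite opprB addrC subrK.
rewrite sum_count_mem sz; lia.
Qed.

(** The sequence consists of all nonzero elements together with 1 and -T - 1. Its total is 0, so any
    n of its n + 1 terms add up to minus the omitted term, which is nonzero. *)
Lemma s_inv2_gt n : (5 <= n)%N -> (n + 1 < s_inv 2 n)%N.
Proof.
move=> n_ge5; have n_gt1 : (1 < n)%N by lia.
pose T : 'Z_n := \sum_a a.
have TN : T + T = 0.
  by rewrite {2}/T (reindex_inj oppr_inj) /= sumrN subrr.
have nat0 m : (0 < m < n)%N -> (m%:R : 'Z_n) != 0.
  case/andP=> m0 mn; rewrite -(inj_eq val_inj) /= val_Zp_nat // modn_small //; lia.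
have neq1 : (1 : 'Z_n) != 0 by rewrite (nat0 1%N) //; lia.
(* As 2T = 0, the value -T - 1 = 0 would give 2 = 0, and -T - 1 = 1 would give 4 = 0; both are
   excluded by n >= 5. *)
have c0 : - T - 1 != 0.
  apply/eqP => c0; have T1 : T = - 1 by apply/eqP; rewrite -addr_eq0 -oppr_eq0 opprD c0.
  have /eqP := nat0 2%N ltac:(lia); apply.
  by rewrite -[2%N]/(1 + 1)%N natrD -[RHS]oppr0 -TN T1 opprD opprK.
have c1 : 1 != - T - 1.
  apply/eqP => c1; have T1 : T = - 2%:R.
    by rewrite -[2%N]/(1 + 1)%N natrD {1}c1 opprD opprB opprK [1 + T]addrC addrK.
  have /eqP := nat0 4%N ltac:(lia); apply.
  by rewrite -[4%N]/(2 + 2)%N natrD -[RHS]oppr0 -TN T1 opprD opprK.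
pose s := [:: 1, - T - 1 & enum [set~ (0 : 'Z_n)]].
have sz : size s = (n + 1)%N.
  by rewrite /s -cat1s /= -cardE cardsC1 card_Zp_type //; lia.
have sums : \sum_(a <- s) a = 0.
  have TE : T = \sum_(a <- enum [set~ (0 : 'Z_n)]) a.
    rewrite big_enum /T (bigD1 0) //= add0r; apply: eq_bigl => a.
    by rewrite !inE.
  by rewrite !big_cons -TE addrA [- T - 1]addrC addrA subrr add0r addNr.
rewrite -sz; apply: s_inv_gt => [a|t t' st szt].
  rewrite /= addnA; apply: (@leq_trans (1 + 1)) => //; apply: leq_add.
    by case: (1 =P a) => [<-|_]; rewrite ?leq_b1 // eq_sym (negbTE c1).
  by rewrite count_uniq_mem ?enum_uniq // leq_b1.
apply/eqP => sumt; have := perm_size st; rewrite sz size_cat szt.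
case: t' st => [|b [|]] //= st; try lia; move=> _.
have : b \in s by rewrite (perm_mem st) mem_cat mem_head orbT.
have -> : b = 0 by rewrite -sums (perm_big _ st) big_cat big_seq1 /= sumt add0r.
rewrite !inE mem_enum !inE eqxx orbF eq_sym (negbTE neq1) eq_sym (negbTE c0) //.
Qed.

(** * Prime moduli *)

Lemma Zp_natr_eq0 n m : (1 < n)%N -> ((m%:R : 'Z_n) == 0) = (n %| m)%N.
Proof. by move=> n1; rewrite -(inj_eq val_inj) /= val_Zp_nat. Qed.

Lemma natr_sum_val n (t : seq 'Z_n) : ((\sum_(b <- t) val b)%N)%:R = \sum_(b <- t) b.
Proof. by rewrite natr_sum; apply: eq_bigr => b _; rewrite natr_Zp. Qed.

Lemma count_map_natr n (y : seq nat) (a : 'Z_n) : (1 < n)%N ->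
    (forall i, i \in y -> (i < n)%N) ->
  count_mem a [seq i%:R | i <- y] = count_mem (val a) y.
Proof.
move=> n1 ltn; rewrite count_map; apply: eq_in_count => i /ltn lti.
by rewrite /= -(inj_eq val_inj) /= val_Zp_nat // modn_small.
Qed.

Lemma s_inv_prime_le p k : prime p -> (2 <= k)%N -> (s_inv k p <= p + k)%N.
Proof.
move=> pr_p k2; have cardZ : #|'Z_p| = p by rewrite card_Zp_type ?prime_gt1.
apply: s_inv_le => [|s sz les]; first by rewrite addn_gt0 prime_gt0.
have [||W [leW Wsum]] := @Cauchy_Davenport_subseq 'Z_p k s _ les; rewrite ?cardZ //.
  by rewrite sz leq_addl.
have : \sum_(a <- s) a \in W.
  suff -> : W = [set: 'Z_p] by rewrite inE.
  apply/eqP; rewrite eqEcard subsetT cardsT; apply: leq_trans leW.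
  by rewrite sz addnK leq_min leqnn cardZ leq_addr.
case/Wsum => t [t' [st szt sumt]]; exists t', t; split.
- by rewrite (permPl st) perm_catC.
- by have := perm_size st; rewrite sz size_cat szt addnC => /addnI.
- apply: (addrI (\sum_(a <- t) a)); rewrite addr0 [RHS]sumt (perm_big _ st).
  by rewrite big_cat.
Qed.

(** Shows that [base] in the construction below has enough copies of each removed term; r < L keeps
    r and L apart, and e > 0 covers r = 1. *)
Lemma count_removed_le k L e q r i :
    (q < k)%N -> (r < L)%N -> (2 <= L)%N -> (0 < e)%N ->
  ((L == i) * q + ((r == i) + (0%N == i) * (k - q - 1)) <=
   k * ((i == 0%N) + (2 <= i < L.+1)) + e * (i == 1%N))%N.
Proof.
move=> ltq ltr L2 e0.
case: (ltngtP 1 i) => i1.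
- have -> : (0%N == i) = false by lia.
  have -> : (i == 0%N) = false by lia.
  have [iL|iL] := ltnP L i.
    have -> : (L == i) = false by lia.
    by have -> : (r == i) = false by lia.
  rewrite ltnS iL; case: (L =P i) => [Li|_]; case: (r =P i) => [ri|_]; lia.
- have -> : i = 0%N by lia.
  have -> : (L == 0%N) = false by lia.
  by case: (r == 0%N); lia.
- have -> : i = 1%N by lia.
  have -> : (L == 1%N) = false by lia.
  by case: (r == 1%N); lia.
Qed.

(* [base], the interval [0, L] with every term taken k times except 1 taken e *)
(* times, has p + 2k - 1 terms. Removing k terms with sum t = qL + r makes    *)
(* the sum -1 modulo p; the bound p >= 4k^2 gives (k - 1) L + 1 < p.          *)
Lemma exists_bounded_list p k : (2 <= k)%N -> (4 * k ^ 2 <= p)%N ->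
  exists L (y : seq nat), [/\ ((k - 1) * L + 1 < p)%N, size y = (p + k - 1)%N,
    (forall i, count_mem i y <= k)%N, (forall i, i \in y -> (i <= L)%N)
    & (p %| (\sum_(i <- y) i).+1)%N].
Proof.
move=> k2 lekp; have k_gt0 : (0 < k)%N by lia.
(* Quotient and shifted remainder are chosen so that [base] has kL + e = p + 2k - 1 terms with 1 <=
   e <= k. *)
pose L := ((p + 2 * k - 2) %/ k)%N; pose e := ((p + 2 * k - 2) %% k).+1.
have eL : (k * L + e = p + 2 * k - 1)%N.
  by have := divn_eq (p + 2 * k - 2) k; rewrite -/L mulnC addnS /e; lia.
have lee : (0 < e <= k)%N by rewrite /e ltn_mod.
have L2 : (2 <= L)%N by rewrite leq_divRL //; lia.
clearbody L e; have /andP[e_gt0 lee'] := lee.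
have kL_p : (k * ((k - 1) * L + 1) < k * p)%N.
  rewrite mulnDr muln1 mulnCA; apply: (@leq_ltn_trans ((k - 1) * (p + 2 * k - 2) + k)).
    by rewrite leq_add2r leq_mul2l; lia.
  clear - lekp k_gt0; case: k lekp k_gt0 => // k lekp _.
  have -> : (k.+1 - 1 = k)%N by lia.
  have -> : (p + 2 * k.+1 - 2 = p + 2 * k)%N by lia.
  by rewrite mulnDr mulSn; move: lekp; rewrite -mulnn; nia.
pose base := flatten (nseq k (0%N :: iota 2 (L - 1))) ++ nseq e 1%N.
have count_base i : count_mem i base
    = (k * ((i == 0%N) + (2 <= i < L.+1)) + e * (i == 1%N))%N.
  rewrite count_cat count_flatten map_nseq sumn_nseq count_nseq /=.
  rewrite count_uniq_mem ?iota_uniq // mem_iota [(L - 1)%N]subn1 addSn addSn.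
  by rewrite prednK ?[1%N == _]eq_sym ?[0%N == _]eq_sym /= 1?mulnC ?[(_ * e)%N]mulnC //; lia.
(* Removing a total of t leaves a sum of -1 modulo p. As t < p <= kL, the quotient q is below k, so
   q copies of L, one r and padding zeros make exactly k terms. *)
pose t := ((\sum_(i <- base) i).+1 %% p)%N; pose q := (t %/ L)%N; pose r := (t %% L)%N.
have p_gt0 : (0 < p)%N by apply: leq_trans lekp; rewrite muln_gt0 expn_gt0 k_gt0.
have t_mod : t = (\sum_(i <- base) i).+1 %[mod p] by rewrite modn_mod.
have t_lt : (t < p)%N by rewrite ltn_mod.
have ltq : (q < k)%N by rewrite ltn_divLR; lia.
have ltr : (r < L)%N by rewrite ltn_mod; lia.
have tE : t = (q * L + r)%N := divn_eq t L.
clearbody q r t.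
pose removed := nseq q L ++ r :: nseq (k - q - 1) 0%N.
have [|u ub remu] := (count_subseqP removed base).1.
  move=> i; rewrite count_base count_cat /= !count_nseq /=.
  exact: count_removed_le.
have [y ybase] := perm_to_subseq ub.
have {ub remu}ybase : perm_eq base (removed ++ y).
  by rewrite (permPl ybase) perm_cat2r perm_sym.
exists L, y; split.
- by rewrite -(ltn_pmul2l k_gt0).
- have := perm_size ybase; rewrite !size_cat /= !size_nseq size_flatten /shape.
  rewrite map_nseq sumn_nseq /= size_iota subn1 prednK; last by lia.
  by rewrite mulnC eL; move: ltq; clear; lia.
- move=> i; apply: (@leq_trans (count_mem i base)).
    by rewrite (seq.permP ybase) count_cat leq_addl.
  rewrite count_base; case: i => [|[|i]] /=; lia.
- move=> i yi; have : (0 < count_mem i base)%N.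
    by rewrite -has_count has_pred1 (perm_mem ybase) mem_cat yi orbT.
  by rewrite count_base; lia.
have sum_base : (\sum_(i <- base) i = t + \sum_(i <- y) i)%N.
  rewrite (perm_big _ ybase) big_cat /=; congr addn.
  rewrite big_cat big_cons /= !big_nseq !iter_addn_0 mul0n addn0.
  by rewrite tE mulnC.
move/eqP: t_mod; rewrite sum_base -addnS -[X in X == _ %[mod _]]addn0.
by rewrite eqn_modDl mod0n eq_sym.
Qed.

(** A zero sum of p terms would leave k - 1 terms of sum -1 modulo p, whose integer sum is at most
    (k - 1)L < p - 1. *)
Lemma s_inv_prime_gt p k : prime p -> (2 <= k)%N -> (4 * k ^ 2 <= p)%N ->
  (p + k - 1 < s_inv k p)%N.
Proof.
move=> pr_p k2 lekp; have [L [y [ltL sizey ley yL sumy]]] := exists_bounded_list k2 lekp.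
have p_gt1 := prime_gt1 pr_p; have p_gt0 := prime_gt0 pr_p.
have ltLp : (L < p)%N by apply: leq_ltn_trans ltL; rewrite addn1 leqW // leq_pmull; lia.
have val_nat m : (m <= L)%N -> val (m%:R : 'Z_p) = m.
  by move=> leL; rewrite /= val_Zp_nat // modn_small // (leq_ltn_trans leL).
pose s := [seq m%:R : 'Z_p | m <- y].
rewrite -sizey -(size_map (fun m => m%:R : 'Z_p) y); apply: s_inv_gt => [a|t t' st szt].
  by rewrite count_map_natr // => i /yL leiL; apply: leq_ltn_trans leiL ltLp.
apply/eqP => sumt.
have szt' : size t' = (k - 1)%N.
  have := perm_size st; rewrite size_map sizey size_cat szt -addnBA; last lia.
  by move=> /addnI.
have t'L b : b \in t' -> (val b <= L)%N.
  move=> bt'; have : b \in t ++ t' by rewrite mem_cat bt' orbT.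
  by rewrite -(perm_mem st) => /mapP[m ym ->]; rewrite val_nat ?yL.
have : (p %| (\sum_(b <- t') val b).+1)%N.
  rewrite -(Zp_natr_eq0 _ p_gt1) mulrSr natr_sum_val.
  have <- : \sum_(b <- s) b = \sum_(b <- t') b.
    by rewrite (perm_big _ st) big_cat /= sumt add0r.
  by rewrite big_map -natr_sum -mulrSr Zp_natr_eq0.
move=> /dvdn_leq -/(_ isT); apply/negP; rewrite -ltnNge.
apply: leq_ltn_trans ltL; rewrite addn1 ltnS -szt' -sum1_size big_distrl /=.
by rewrite big_seq [leqRHS]big_seq leq_sum // => b bt'; rewrite mul1n t'L.
Qed.

(** * Davenport Z-sequences of order sqrt(nk) *)

Lemma davenportZ_of_large n k m (x : m.-tuple 'Z_n) : (1 < n)%N -> (0 < k)%N ->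
  (1344 * (n * k) <= m ^ 2)%N -> x \in Xseq k n m -> davenportZ n x.
Proof.
move=> n1 k0 large; rewrite inE => /forallP x_le; apply: contraLR large => notD.
rewrite -ltnNge -{1}(size_tuple x).
have zsx : zero_sum_free (x : seq 'Z_n).
  move=> t t' xt sumt; apply: contraNeq notD => t0.
  by apply/davenportZP; exists t, t'.
have : (#|ssum x| <= n)%N.
  by rewrite -[leqRHS](card_Zp_type n1) max_card.
have ssum_gt0 : (0 < #|ssum x|)%N by apply/card_gt0P; exists 0; apply: ssum0.
move=> le_n; apply: leq_ltn_trans (leq_sqr_size_ssum zsx x_le) _.
rewrite -mulnA ltn_pmul2l // [ltnRHS]mulnC ltn_pmul2l //.
by rewrite subn1 prednK.
Qed.

(** The sequence 1, 2, 3, ... with each value k times, cut at length m, has integer total below n,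
    so no nonempty part of it has a sum divisible by n. *)
Lemma exists_not_davenportZ n k m : (2 <= k < n)%N -> (4 * m ^ 2 <= n * k)%N ->
  exists y : m.-tuple 'Z_n, y \in Xseq k n m /\ ~~ davenportZ n y.
Proof.
case/andP=> k2 kn small; have k0 : (0 < k)%N by lia.
have n1 : (1 < n)%N by lia.
pose z := [seq (i %/ k).+1 | i <- iota 0 m].
have sumz : (\sum_(i <- z) i < n)%N.
  (* Each term times k is at most m + k. Then m(m + k) < nk follows from m^2 <= nk / 4 and 2mk < nk,
     the latter since (2mk)^2 <= nk^3 and k < n. *)
  rewrite -(ltn_pmul2l k0) (@leq_ltn_trans (m * (m + k))) //.
    rewrite big_map big_distrr /= -{2}[m](size_iota 0) -sum1_size big_distrl /=.
    rewrite big_seq [leqRHS]big_seq leq_sum // => i; rewrite mem_iota => /andP[_ im].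
    rewrite mul1n mulnS addnC leq_add2r mulnC.
    exact: leq_trans (leq_divM _ _) (ltnW im).
  have : (2 * (m * k) < n * k)%N.
    rewrite -ltn_sqr; apply: (@leq_ltn_trans (k ^ 2 * (4 * m ^ 2))); first by rewrite !expnMn; lia.
    apply: (@leq_ltn_trans (k ^ 2 * (n * k))); first by rewrite leq_mul2l small orbT.
    by rewrite expnMn mulnC -!mulnn; nia.
  move: small; rewrite -mulnn mulnDr [(k * n)%N]mulnC; lia.
have z_lt i : i \in z -> (i < n)%N.
  by move=> iz; apply: leq_ltn_trans sumz; rewrite (big_rem i) //= leq_addr.
have sz : size [seq i%:R : 'Z_n | i <- z] == m by rewrite !size_map size_iota.
exists (Tuple sz); split.
  rewrite inE; apply/forallP => a; rewrite /= count_map_natr //.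
  rewrite count_map -size_filter -[leqRHS](size_iota ((val a).-1 * k) k).
  apply: uniq_leq_size => [|i]; first by rewrite filter_uniq ?iota_uniq.
  rewrite mem_filter mem_iota /= => /andP[/eqP ia _]; rewrite mem_iota -ia /= leq_divM /=.
  by rewrite addnC -mulSn ltn_ceil.
apply/negP => /davenportZP[t [t' [/= zt t0 /eqP]]].
rewrite -natr_sum_val Zp_natr_eq0 // => dvd_sum.
have tz : {subset t <= [seq i%:R : 'Z_n | i <- z]}.
  by move=> b tb; rewrite (perm_mem zt) mem_cat tb.
have sum_t : (\sum_(b <- t) val b < n)%N.
  apply: leq_ltn_trans sumz.
  have -> : (\sum_(i <- z) i = \sum_(b <- [seq i%:R : 'Z_n | i <- z]) val b)%N.
    rewrite [RHS]big_map big_seq [RHS]big_seq; apply: eq_bigr => i /z_lt lti.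
    by rewrite /= val_Zp_nat // modn_small.
  by rewrite (perm_big _ zt) big_cat /= leq_addr.
case: t t0 dvd_sum tz sum_t {zt} => // b t _ dvd_sum tz; apply/negP; rewrite -leqNgt.
apply: dvdn_leq dvd_sum; rewrite big_cons addn_gt0; apply/orP; left.
have /tz/mapP[i iz ->] := mem_head b t.
by rewrite /= val_Zp_nat // modn_small ?z_lt //; case/mapP: iz => j _ ->.
Qed.

Theorem theorem1 (R : realType) :
  [/\ forall n : nat, (5 <= n)%N -> s_inv 2 n = (n + 2)%N,
      (forall p k : nat, prime p -> (5 <= p)%N -> (2 <= k <= p - 1)%N ->
         (s_inv k p <= p + k)%N) /\
      (forall k : nat, (2 <= k)%N ->
         exists p0 : nat, forall p : nat,
           prime p -> (p0 <= p)%N -> (k <= p - 1)%N ->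
           s_inv k p = (p + k)%N)
    & exists c C : R, [/\ 0 < c, 0 < C &
        forall n k : nat, (2 <= k <= n - 1)%N ->
          (forall x : `|Num.ceil (C * Num.sqrt ((n * k)%:R : R))|%N.-tuple 'Z_n,
             x \in Xseq k n _ -> davenportZ n x) /\
          (exists y : `|Num.floor (c * Num.sqrt ((n * k)%:R : R))|%N.-tuple 'Z_n,
             y \in Xseq k n _ /\ ~~ davenportZ n y)]].
Proof.
split.
- move=> n n5; apply/eqP; rewrite eqn_leq s_inv2_le; last lia.
  by rewrite addnS; apply: s_inv2_gt.
- split=> [p k pr_p _ /andP[k2 _]|k k2]; first exact: s_inv_prime_le.
  exists (4 * k ^ 2)%N => p pr_p lekp _; apply/eqP; rewrite eqn_leq s_inv_prime_le //.
  have := s_inv_prime_gt pr_p k2 lekp.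
  by rewrite -addnBA ?(ltnW k2) // subn1 -addnS prednK // ltnW.
(* 1/2 comes from the condition 4 m^2 <= nk, and 37 from 37^2 = 1369 >= 1344. *)
exists 2^-1, 37%:R; split; rewrite ?invr_gt0 ?ltr0n // => n k /andP[k2 kn].
have sqrtK : Num.sqrt ((n * k)%:R : R) ^+ 2 = (n * k)%:R by rewrite sqr_sqrtr ?ler0n.
have sqrt0 : 0 <= Num.sqrt ((n * k)%:R : R) := sqrtr_ge0 _.
split.
  set w := Num.ceil _.
  have : 37%:R * Num.sqrt ((n * k)%:R : R) <= (`|w|%N)%:R.
    by rewrite natr_absz; apply: le_trans (ceil_ge _) _; rewrite ler_int ler_norm.
  move: (`|w|%N) => m lem x; apply: davenportZ_of_large; [lia|lia|].
  apply: (@leq_trans (1369 * (n * k))); first by rewrite leq_mul2r orbT.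
  rewrite -(ler_nat R) natrX natrM -sqrtK (_ : 1369%:R = 37%:R ^+ 2 :> R).
    by rewrite -exprMn ler_sqr ?nnegrE ?mulr_ge0 ?ler0n.
  by rewrite -natrX.
have : (`|Num.floor (2^-1 * Num.sqrt ((n * k)%:R : R))|%N)%:R <=
       2^-1 * Num.sqrt ((n * k)%:R : R).
  rewrite natr_absz ger0_norm ?floor_le // floor_ge_int mulr_ge0 ?invr_ge0 ?ler0n //.
move: (`|_|%N) => m lem; apply: exists_not_davenportZ; first lia.
rewrite -(ler_nat R) natrM natrX -sqrtK -[4%:R]/((2 * 2)%:R) natrM -expr2 -exprMn.
rewrite ler_sqr ?nnegrE ?mulr_ge0 ?ler0n //.
by rewrite -ler_pdivlMl ?ltr0n.
Qed.
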